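(* Let $\Omega=(0,1)^2$ and let $\Omega_h$ be a conforming mesh of $\Omega$ into (nondegenerate convex) quadrilaterals. Consider the $Q^1$ finite element scheme with mixed quadrature on $\Omega_h$ (see context) for the boundary value problem $-\nabla\cdot(\mathbf a\nabla u)+cu=f$ in $\Omega$, $u=g$ on $\partial\Omega$, with $\mathbf a$ symmetric uniformly positive definite and $c\ge0$. For each $e\in\Omega_h$ let $\tilde{\mathbf a}=(\tilde a_e^{ij})=|\det(DF_h)|\,DF_h^{-1}\,\bar{\mathbf a}_e\,DF_h^{-T}$, where $DF_h$ is the Jacobian matrix at the center of the reference square of the bilinear map $\mathbf F_e:[0,1]^2\to e$ and $\bar{\mathbf a}_e=\mathbf a(\mathbf F_e(\tfrac12,\tfrac12))$. Suppose that on every element $e$ either $$|\tilde a_e^{12}|\le\min\{\tilde a_e^{11},\tilde a_e^{22}\},$$ or the (equivalent) mesh condition $$(\overrightarrow{\mathbf c_0}+\overrightarrow{\mathbf c_2})^T\bar{\mathbf a}_e^{-1}(\overrightarrow{\mathbf c_0}+\overrightarrow{\mathbf c_3})\ge0,\quad(\overrightarrow{\mathbf c_0}+\overrightarrow{\mathbf c_2})^T\bar{\mathbf a}_e^{-1}(\overrightarrow{\mathbf c_0}-\overrightarrow{\mathbf c_1})\ge0,$$ $$(\overrightarrow{\mathbf c_1}+\overrightarrow{\mathbf c_3})^T\bar{\mathbf a}_e^{-1}(\overrightarrow{\mathbf c_0}+\overrightarrow{\mathbf c_3})\ge0,\quad(\overrightarrow{\mathbf c_1}+\overrightarrow{\mathbf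 c_3})^T\bar{\mathbf a}_e^{-1}(\overrightarrow{\mathbf c_1}-\overrightarrow{\mathbf c_0})\ge0$$ holds, and that the quadrature parameters on each $e$ are chosen as $$\lambda_e^1,\lambda_e^2\in\left(\frac{|\tilde a^{11}_e-\tilde a^{22}_e|}{\tilde a^{11}_e+\tilde a^{22}_e},\ 1-\frac{2|\tilde a^{12}_e|}{\tilde a^{11}_e+\tilde a^{22}_e}\right]$$ (with $\lambda_e^1=\lambda_e^2$ equal to the right endpoint when $|\tilde a_e^{12}|=\min\{\tilde a_e^{11},\tilde a_e^{22}\}$). Then the stiffness matrix $A=(\mathcal A_h(\varphi_j,\varphi_i))_{i,j=1}^{N_h}$ is a (nonsingular) $M$-matrix.
   Context: Coefficients $\mathbf a$, $c$ are sufficiently smooth on $\bar\Omega$. For an element $e$ with vertices $\mathbf c_{0,0},\mathbf c_{1,0},\mathbf c_{1,1},\mathbf c_{0,1}$ in cyclic order, $\mathbf F_e=\sum_{\ell,m\in\{0,1\}}\mathbf c_{\ell,m}\hat\phi_{\ell,m}$ is the bilinear map $\hat K=[0,1]^2\to e$, where $\hat\phi_{0,0}=(1-\hat x_1)(1-\hat x_2)$, $\hat\phi_{0,1}=(1-\hat x_1)\hat x_2$, $\hat\phi_{1,1}=\hat x_1\hat x_2$, $\hat\phi_{1,0}=\hat x_1(1-\hat x_2)$; $DF_e$ is its Jacobian matrix and $DF_h=DF_e(\frac12,\frac12)$. Edge vectors: $\overrightarrow{\mathbf c_0}=\mathbf c_{0,1}-\mathbf c_{0,0}$, $\overrightarrow{\mathbf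 c_1}=\mathbf c_{1,0}-\mathbf c_{0,0}$, $\overrightarrow{\mathbf c_2}=\mathbf c_{1,1}-\mathbf c_{1,0}$, $\overrightarrow{\mathbf c_3}=\mathbf c_{1,1}-\mathbf c_{0,1}$. $V^h$ is the space of continuous functions $v$ on $\bar\Omega$ with $v|_e\circ\mathbf F_e$ bilinear on $\hat K$ for all $e$. Interior vertices are $\mathbf x_1,\dots,\mathbf x_{N_h}$ ($N_h\ge1$), and $\varphi_i\in V^h$ is the nodal basis function equal to $1$ at $\mathbf x_i$ and $0$ at all other vertices. Mixed quadrature on $\hat K$: for $\lambda\in[0,1]$ put $\omega_1(\lambda)=\omega_3(\lambda)=\lambda/2$, $\omega_2(\lambda)=1-\lambda$, $\xi_1=0,\xi_2=\frac12,\xi_3=1$; for $\boldsymbol\lambda=(\lambda^1,\lambda^2)$, $\int_{\hat K}\hat f\,d^h_{\boldsymbol\lambda}\hat{\mathbf x}:=\sum_{p,q=1}^3\omega_p(\lambda^1)\omega_q(\lambda^2)\hat f(\xi_p,\xi_q)$; $d_1^h$ denotes $\boldsymbol\lambda=(1,1)$. The scheme's bilinear form on the quadrilateral mesh is $$\mathcal A_h(u_h,v_h)=\sum_e\left(\int_{\hat K}(\tilde{\mathbf a}\hat\nabla\hat u_h)\cdot\hat\nabla\hat v_h\,d^h_{\boldsymbol\lambda_e}\hat{\mathbf x}+\int_{\hat K}\hat c\,\hat u_h\hat v_h\,|\det DF_e|\,d^h_1\hat{\mathbf x}\right),$$ where hats denote composition with $\mathbf F_e$, $\hat\nabla$ is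 the gradient in $\hat{\mathbf x}$, and $\boldsymbol\lambda_e=(\lambda_e^1,\lambda_e^2)$. A nonsingular $M$-matrix is a real square matrix with nonpositive off-diagonal entries that is invertible with entrywise nonnegative inverse. *)

(* Defs.v *)
From HB Require Import structures.
From mathcomp Require Import all_boot all_order all_algebra.
From mathcomp Require Import all_classical all_reals all_analysis.

Set Implicit Arguments.
Unset Strict Implicit.
Unset Printing Implicit Defensive.

Import Order.TTheory GRing.Theory Num.Theory.
Import numFieldNormedType.Exports.

Local Open Scope classical_set_scope.
Local Open Scope ring_scope.

Definition dot (R : realType) (u v : 'cV[R]_2) : R := (u^T *m v) 0 0.

Definition vec2 (R : realType) (s t : R) : 'cV[R]_2 :=
  \col_(i < 2) (if i == 0 then s else t).

Definition Omega (R : realType) : set 'cV[R]_2 :=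
  [set x | forall i, 0 < x i 0 < 1].

Definition Khat (R : realType) : set 'cV[R]_2 :=
  [set x | forall i, 0 <= x i 0 <= 1].

(* [q l m] is the vertex c_{l,m}; [false] stands for 0 and [true] for 1. *)
Definition quad (R : realType) := bool -> bool -> 'cV[R]_2.

Definition phihat (R : realType) (l m : bool) (xh : 'cV[R]_2) : R :=
  (if l then xh 0 0 else 1 - xh 0 0) * (if m then xh 1 0 else 1 - xh 1 0).

Definition Fmap (R : realType) (q : quad R) (xh : 'cV[R]_2) : 'cV[R]_2 :=
  \sum_(l : bool) \sum_(m : bool) phihat l m xh *: q l m.

Definition DF (R : realType) (q : quad R) (xh : 'cV[R]_2) : 'M[R]_2 :=
  \matrix_(i < 2, j < 2) 'D_(delta_mx j 0) (fun y => Fmap q y i 0) xh.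

Definition elem (R : realType) (q : quad R) : set 'cV[R]_2 :=
  Fmap q @` @Khat R.

Definition edge0 (R : realType) (q : quad R) := q false true - q false false.
Definition edge1 (R : realType) (q : quad R) := q true false - q false false.
Definition edge2 (R : realType) (q : quad R) := q true true - q true false.
Definition edge3 (R : realType) (q : quad R) := q true true - q false true.

Definition segment (R : realType) (p r : 'cV[R]_2) : set 'cV[R]_2 :=
  [set (1 - t) *: p + t *: r | t in `[0, 1] ].

Definition is_vertex (R : realType) (q : quad R) (p : 'cV[R]_2) : Prop :=
  exists l m, p = q l m.

Definition is_edge (R : realType) (q : quad R) (S : set 'cV[R]_2) : Prop :=
  exists k : bool,
    S = segment (q k false) (q k true) \/ S = segment (q false k) (q true k).

(* Positive iff the path p -> r -> s makes a strict left turn at r. *)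
Definition turn (R : realType) (p r s : 'cV[R]_2) : R :=
  \det (row_mx (r - p) (s - r) : 'M[R]_2).

(* For every side of the closed path c_{0,0}, c_{1,0}, c_{1,1}, c_{0,1}, the
   other two vertices lie strictly on the same side of its line; both
   orientations are allowed. *)
Definition convex_quad (R : realType) (q : quad R) : Prop :=
  let c00 := q false false in let c10 := q true false in
  let c11 := q true true in let c01 := q false true in
  [/\ 0 < turn c00 c10 c11, 0 < turn c10 c11 c01,
      0 < turn c11 c01 c00 & 0 < turn c01 c00 c10] \/
  [/\ turn c00 c10 c11 < 0, turn c10 c11 c01 < 0,
      turn c11 c01 c00 < 0 & turn c01 c00 c10 < 0].

Definition conforming_mesh (R : realType) (E : finType) (mesh : E -> quad R)
    : Prop :=
  [/\ forall e, convex_quad (mesh e),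
      \bigcup_(e in setT) elem (mesh e) = closure (@Omega R) &
      forall e e', e != e' ->
        let I := elem (mesh e) `&` elem (mesh e') in
        [\/ I = set0,
            exists p, [/\ is_vertex (mesh e) p, is_vertex (mesh e') p
                        & I = [set p]]
          | is_edge (mesh e) I /\ is_edge (mesh e') I]].

Definition mesh_vertex (R : realType) (E : finType) (mesh : E -> quad R)
    (p : 'cV[R]_2) : Prop := exists e, is_vertex (mesh e) p.

Definition interior_vertices (R : realType) (E : finType) (mesh : E -> quad R)
    (N : nat) (x : 'I_N -> 'cV[R]_2) : Prop :=
  injective x /\
  forall p, (exists i, x i = p) <-> (mesh_vertex mesh p /\ Omega p).

Definition bilinear_on_Khat (R : realType) (f : 'cV[R]_2 -> R) : Prop :=
  exists b0 b1 b2 b3 : R, forall xh, Khat xh ->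
    f xh = b0 + b1 * xh 0 0 + b2 * xh 1 0 + b3 * (xh 0 0 * xh 1 0).

(* Only the values of [v] on the closure of Omega are meaningful. *)
Definition Vh (R : realType) (E : finType) (mesh : E -> quad R)
    (v : 'cV[R]_2 -> R) : Prop :=
  {within closure (@Omega R), continuous v} /\
  forall e, bilinear_on_Khat (v \o Fmap (mesh e)).

Definition nodal_basis (R : realType) (E : finType) (mesh : E -> quad R)
    (N : nat) (x : 'I_N -> 'cV[R]_2) (phi : 'I_N -> 'cV[R]_2 -> R) : Prop :=
  forall i, [/\ Vh mesh (phi i), phi i (x i) = 1 &
    forall p, mesh_vertex mesh p -> p <> x i -> phi i p = 0].

Definition omega (R : realType) (lam : R) (p : 'I_3) : R :=
  nth 0 [:: lam / 2; 1 - lam; lam / 2] p.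

Definition xi (R : realType) (p : 'I_3) : R := nth 0 [:: 0; 1 / 2; 1] p.

Definition quadrature (R : realType) (lam : R * R) (f : 'cV[R]_2 -> R) : R :=
  \sum_(p < 3) \sum_(q < 3)
    omega lam.1 p * omega lam.2 q * f (vec2 (xi R p) (xi R q)).

(* Gradient of a function on Khat.  The difference quotients only use points
   of Khat, since quadrature nodes lie on its boundary and the composition of
   a finite element function with F_e is only meaningful on Khat. *)
Definition grad_Khat (R : realType) (f : 'cV[R]_2 -> R) (xh : 'cV[R]_2)
    : 'cV[R]_2 :=
  \col_(i < 2)
    lim ((fun h : R => h^-1 * (f (xh + h *: delta_mx i 0) - f xh)) @
         within [set h | Khat (xh + h *: delta_mx i 0)] (0 : R)^').

Definition center (R : realType) : 'cV[R]_2 := vec2 (1 / 2) (1 / 2).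

Definition abar (R : realType) (a : 'cV[R]_2 -> 'M[R]_2) (q : quad R)
    : 'M[R]_2 := a (Fmap q (center R)).

Definition atilde (R : realType) (a : 'cV[R]_2 -> 'M[R]_2) (q : quad R)
    : 'M[R]_2 :=
  let DFh := DF q (center R) in
  `|\det DFh| *: (invmx DFh *m abar a q *m (invmx DFh)^T).

Definition bilinear_form (R : realType) (E : finType) (mesh : E -> quad R)
    (a : 'cV[R]_2 -> 'M[R]_2) (c : 'cV[R]_2 -> R) (lam : E -> R * R)
    (u v : 'cV[R]_2 -> R) : R :=
  \sum_(e : E)
    let F := Fmap (mesh e) in
    (quadrature (lam e) (fun xh =>
       dot (atilde a (mesh e) *m grad_Khat (u \o F) xh)
           (grad_Khat (v \o F) xh))
     + quadrature (1, 1) (fun xh =>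
       c (F xh) * u (F xh) * v (F xh) * `|\det (DF (mesh e) xh)|)).

Definition stiffness (R : realType) (E : finType) (mesh : E -> quad R)
    (a : 'cV[R]_2 -> 'M[R]_2) (c : 'cV[R]_2 -> R) (lam : E -> R * R)
    (N : nat) (phi : 'I_N -> 'cV[R]_2 -> R) : 'M[R]_N :=
  \matrix_(i < N, j < N) bilinear_form mesh a c lam (phi j) (phi i).

Definition unif_posdef (R : realType) (D : set 'cV[R]_2)
    (a : 'cV[R]_2 -> 'M[R]_2) : Prop :=
  exists2 alpha : R, 0 < alpha &
    forall x, D x -> forall z : 'cV[R]_2,
      alpha * dot z z <= dot z (a x *m z).

Definition coef_condition (R : realType) (ta : 'M[R]_2) : Prop :=
  `|ta 0 1| <= Num.min (ta 0 0) (ta 1 1).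

Definition mesh_condition (R : realType) (q : quad R) (ab : 'M[R]_2) : Prop :=
  let c0 := edge0 q in let c1 := edge1 q in
  let c2 := edge2 q in let c3 := edge3 q in
  [/\ 0 <= dot (c0 + c2) (invmx ab *m (c0 + c3)),
      0 <= dot (c0 + c2) (invmx ab *m (c0 - c1)),
      0 <= dot (c1 + c3) (invmx ab *m (c0 + c3)) &
      0 <= dot (c1 + c3) (invmx ab *m (c1 - c0))].

Definition lam_left (R : realType) (ta : 'M[R]_2) : R :=
  `|ta 0 0 - ta 1 1| / (ta 0 0 + ta 1 1).

Definition lam_right (R : realType) (ta : 'M[R]_2) : R :=
  1 - 2 * `|ta 0 1| / (ta 0 0 + ta 1 1).

(* In the equality case the half-open interval is empty, and both parameters
   equal its right endpoint. *)
Definition admissible_lam (R : realType) (ta : 'M[R]_2) (lam : R * R)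
    : Prop :=
  if `|ta 0 1| == Num.min (ta 0 0) (ta 1 1)
  then lam.1 = lam_right ta /\ lam.2 = lam_right ta
  else lam.1 \in `]lam_left ta, lam_right ta] /\
       lam.2 \in `]lam_left ta, lam_right ta].

Definition nonsingular_M_matrix (R : realType) (N : nat) (A : 'M[R]_N)
    : Prop :=
  [/\ forall i j, i != j -> A i j <= 0,
      A \in unitmx &
      forall i j, 0 <= invmx A i j].

(* Main.v *)
(* On an element, the quadrature turns the stiffness form into an explicit
   symmetric form in the four corner values.  Its rows sum to zero, and the
   admissible range of lambda is what makes its off-diagonal entries nonpositive
   and its kernel the constants; vertex quadrature makes the mass term diagonal.
   So the stiffness matrix has nonpositive off-diagonal entries, and a vector in
   the kernel of its quadratic form is a continuous function that is constant on
   each element, hence constant on the square, hence zero because a corner of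
   the square is a boundary vertex.  A positive definite matrix with nonpositive
   off-diagonal entries is an M-matrix: test with the negative part of a column
   of the inverse. *)

Require Import Defs.
From mathcomp Require Import all_boot all_order all_algebra.
From mathcomp Require Import all_classical all_reals all_analysis.
From mathcomp Require Import ring lra.

Set Implicit Arguments.
Unset Strict Implicit.
Unset Printing Implicit Defensive.

Import Order.TTheory GRing.Theory Num.Theory.
Import numFieldNormedType.Exports.

Local Open Scope classical_set_scope.
Local Open Scope ring_scope.

(** * M-matrices from positive definiteness *)

Lemma nonsingular_M_matrix_posdef (R : realType) (N : nat) (A : 'M[R]_N) :
  (forall i j, i != j -> A i j <= 0) ->
  (forall z : 'I_N -> R,
     \sum_i \sum_j z i * A i j * z j <= 0 -> forall i, z i = 0) ->
  nonsingular_M_matrix A.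
Proof.
move=> Aoff Apos.
have Aunit : A \in unitmx.
  rewrite -row_free_unit; apply: inj_row_free => v vA0.
  apply/rowP => i; rewrite mxE; apply: (Apos (v 0)).
  rewrite exchange_big /= big1 // => j _.
  rewrite -mulr_suml; have /rowP/(_ j) := vA0; rewrite !mxE => ->.
  by rewrite mul0r.
split=> // i j.
(* [z] is the negative part of the column [y] of the inverse, so [y + z] is its positive part and
   the two have disjoint supports. *)
pose y k := invmx A k j; pose z k := Num.max (- y k) 0.
have z_ge0 k : 0 <= z k by rewrite /z le_max lexx orbT.
have yz_ge0 k : 0 <= y k + z k by rewrite /z; case: (leP (- y k) 0) => ?; lra.
have zyz k : z k * (y k + z k) = 0.
  by rewrite /z; case: leP => ?; rewrite ?mul0r // subrr mulr0.
have Ay k : \sum_l A k l * y l = (k == j)%:R.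
  by have /matrixP/(_ k j) := mulmxV Aunit; rewrite !mxE.
suff /Apos/(_ i) : \sum_k \sum_l z k * A k l * z l <= 0.
  by rewrite /z /y; case: (leP (- invmx A i j) 0); lra.
(* Split [z] as [(y + z) - y]: since A y is the [j]-th unit vector, [y] contributes exactly [z j].
   What remains pairs the negative with the positive part, so only off-diagonal entries of [A]
   count. *)
have -> : \sum_k \sum_l z k * A k l * z l =
    \sum_k \sum_l z k * A k l * (y l + z l) - z j.
  have -> : z j = \sum_k z k * (k == j)%:R.
    rewrite (bigD1 j) //= eqxx mulr1 big1 ?addr0 // => k /negbTE->.
    by rewrite mulr0.
  rewrite -sumrB; apply: eq_bigr => k _; rewrite -Ay mulr_sumr -sumrB.
  by apply: eq_bigr => l _; ring.
rewrite subr_le0; apply: (le_trans _ (z_ge0 j)).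
apply: sumr_le0 => k _; apply: sumr_le0 => l _.
have [->|kl] := eqVneq k l; first by rewrite mulrAC zyz mul0r.
by rewrite -mulrA mulr_ge0_le0 // mulr_le0_ge0 // Aoff.
Qed.

(** * The element stiffness form in the four corner values *)

Section LocalForm.
Context {R : realType}.
Implicit Types (w : bool -> bool -> R) (ta : 'M[R]_2).

(* Mean derivatives along the two axes, and mixed second difference, of the
   bilinear function with corner values [w]. *)
Definition mean1 w : R :=
  (w true false + w true true - w false false - w false true) / 2.
Definition mean2 w : R :=
  (w false true + w true true - w false false - w true false) / 2.
Definition mixed w : R :=
  (w false false + w true true - w true false - w false true) / 2.

(** The closed form of the mixed-quadrature stiffness integral on one element;
    [quadrature_stiffness] proves the agreement. *)
Definition local_form ta (lam : R * R) w w' : R :=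
  ta 0 0 * (mean1 w * mean1 w') + ta 0 1 * (mean2 w * mean1 w')
  + ta 1 0 * (mean1 w * mean2 w') + ta 1 1 * (mean2 w * mean2 w')
  + (lam.2 * ta 0 0 + lam.1 * ta 1 1) * (mixed w * mixed w').

Definition sym_posdef2 ta : Prop :=
  [/\ ta 1 0 = ta 0 1, 0 < ta 0 0, 0 < ta 1 1
    & ta 0 1 ^+ 2 < ta 0 0 * ta 1 1].

(** Let p, q, t be the entries (0,0), (1,1), (0,1) of [ta] and X = lam.2 p + lam.1 q. Since X / (p +
    q) is a weighted mean of the two parameters, it obeys the same interval bounds as they do. The
    first three conclusions amount to |p - q| <= X <= p + q - 2|t|; they are the sign conditions
    used in [local_form_le0]. *)
Lemma admissible_lam_bounds ta lam :
  sym_posdef2 ta -> admissible_lam ta lam ->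
  [/\ (1 - lam.1) * ta 1 1 <= (1 + lam.2) * ta 0 0,
      (1 - lam.2) * ta 0 0 <= (1 + lam.1) * ta 1 1,
      2 * `|ta 0 1| <= (1 - lam.2) * ta 0 0 + (1 - lam.1) * ta 1 1
    & 0 < lam.2 * ta 0 0 + lam.1 * ta 1 1].
Proof.
rewrite /sym_posdef2 /admissible_lam /lam_left /lam_right.
move: (ta 0 0) (ta 1 1) (ta 0 1) (ta 1 0) => p q t t' [_ p0 q0 tpq] lamP.
have s0 : 0 < p + q by lra.
(* Strict inequality of arithmetic and geometric means, from t^2 < p q. It gives X > 0 in the
   equality case. *)
have tlt : 2 * `|t| < p + q.
  move: (normr_ge0 t) (sqr_ge0 (p - q)) tpq.
  rewrite -(real_normK (num_real t)); move: `|t| => u u0 sq upq.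
  rewrite ltNge; apply/negP => ule.
  have : (p + q) ^+ 2 <= (2 * u) ^+ 2 by rewrite lerXn2r ?nnegrE; lra.
  by move: sq upq; rewrite !expr2; lra.
suff [dX Xs X0] : [/\ `|p - q| <= lam.2 * p + lam.1 * q,
    lam.2 * p + lam.1 * q <= p + q - 2 * `|t| & 0 < lam.2 * p + lam.1 * q].
  by move: dX; rewrite ler_norml => /andP[]; split; lra.
move: lamP.
case: lam => l1 l2 /=; case: ifP => [/eqP tmin [-> ->]|_ []].
  (* Here |t| = min(p, q), and |p - q| = p + q - 2 min(p, q), so X attains both of its bounds. *)
  rewrite -mulrDr mulrBl mul1r divfK ?gt_eqF //; split=> //; last by lra.
  rewrite tmin minEle ler_norml; case: ifP => [|/negbT]; rewrite -?ltNge; lra.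
rewrite !in_itv /= => /andP[L1 R1] /andP[L2 R2].
have {L1 R1} [] : `|p - q| < l1 * (p + q) /\ l1 * (p + q) <= p + q - 2 * `|t|.
  by rewrite -ltr_pdivrMr // -ler_pdivlMr // mulrBl divff ?gt_eqF.
have {L2 R2} [] : `|p - q| < l2 * (p + q) /\ l2 * (p + q) <= p + q - 2 * `|t|.
  by rewrite -ltr_pdivrMr // -ler_pdivlMr // mulrBl divff ?gt_eqF.
move: (normr_ge0 (p - q)) (normr_ge0 t); move: `|_| `|_| => d u d0 u0 L2 R2 L1 R1.
have l1_gt0 : 0 < l1 by rewrite -(pmulr_lgt0 _ s0); lra.
have l2_gt0 : 0 < l2 by rewrite -(pmulr_lgt0 _ s0); lra.
by split; [rewrite -(ler_pM2r s0); nra | rewrite -(ler_pM2r s0); nra | nra].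
Qed.

(** Disjoint supports leave only products of values at different corners; their coefficients are the
    off-diagonal entries of the element stiffness matrix. Stating this for arbitrary nonnegative
    corner values avoids a case analysis on which corners carry the two nodes. *)
Lemma local_form_le0 ta lam w w' :
  sym_posdef2 ta -> admissible_lam ta lam ->
  (forall l m, 0 <= w l m) -> (forall l m, 0 <= w' l m) ->
  (forall l m, w l m * w' l m = 0) -> local_form ta lam w w' <= 0.
Proof.
move=> taP lamP w0 w'0 ww'; have [k1 k2 k3 _] := admissible_lam_bounds taP lamP.
have [tsym _ _ _] := taP; rewrite /local_form tsym /mean1 /mean2 /mixed.
move: (ww' false false) (ww' false true) (ww' true false) (ww' true true).
have P l m l' m' : 0 <= w l m * w' l' m' by rewrite mulr_ge0.
have := P false false true false; have := P true false false false.
have := P false false false true; have := P false true false false.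
have := P false false true true; have := P true true false false.
have := P false true true false; have := P true false false true.
have := P false true true true; have := P true true false true.
have := P true false true true; have := P true true true false.
have := ler_norm (- ta 0 1); rewrite normrN; have := ler_norm (ta 0 1).
move: (w false false) (w false true) (w true false) (w true true).
move: (w' false false) (w' false true) (w' true false) (w' true true).
move: `|_| k1 k2 k3 => u; move: (ta 0 0) (ta 1 1) (ta 0 1) => p q t k1 k2 k3.
case: lam k1 k2 k3 {lamP} => l1 l2 /= k1 k2 k3.
move=> z00 z01 z10 z11 w00 w01 w10 w11 tu1 tu2.
move=> h1 h2 h3 h4 h5 h6 h7 h8 h9 h10 h11 h12 e1 e2 e3 e4.
have k3' : 0 <= (1 - l2) * p + (1 - l1) * q + 2 * t by lra.
have k4 : 0 <= (1 - l2) * p + (1 - l1) * q - 2 * t by lra.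
rewrite -subr_ge0 in k1; rewrite -subr_ge0 in k2.
rewrite -oppr_ge0 -(@pmulr_rge0 _ 4) //.
(* In the first four lines, the first factor is -4 times an off-diagonal entry
   of the element stiffness matrix. *)
set lhs := (X in 0 <= X).
have -> : lhs =
    ((1 + l2) * p - (1 - l1) * q) * (w00 * z10 + w10 * z00 + w01 * z11 + w11 * z01)
  + ((1 + l1) * q - (1 - l2) * p) * (w00 * z01 + w01 * z00 + w10 * z11 + w11 * z10)
  + ((1 - l2) * p + (1 - l1) * q + 2 * t) * (w00 * z11 + w11 * z00)
  + ((1 - l2) * p + (1 - l1) * q - 2 * t) * (w01 * z10 + w10 * z01)
  - ((1 + l2) * p + (1 + l1) * q + 2 * t) * (w00 * z00 + w11 * z11)
  - ((1 + l2) * p + (1 + l1) * q - 2 * t) * (w01 * z01 + w10 * z10).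
  by rewrite /lhs; field.
rewrite e1 e2 e3 e4 !addr0 !mulr0 !subr0.
by rewrite !addr_ge0 ?mulr_ge0 // !addr_ge0.
Qed.

(** Completes the square in [mean1 w]. With [admissible_lam_bounds] all three weights are positive,
    which yields both nonnegativity and the kernel. *)
Lemma local_form_diag ta lam w : sym_posdef2 ta ->
  local_form ta lam w w =
    (ta 0 0 * mean1 w + ta 0 1 * mean2 w) ^+ 2 / ta 0 0
    + (ta 0 0 * ta 1 1 - ta 0 1 ^+ 2) * mean2 w ^+ 2 / ta 0 0
    + (lam.2 * ta 0 0 + lam.1 * ta 1 1) * mixed w ^+ 2.
Proof.
by case=> tsym p0 _ _; rewrite /local_form tsym; field; rewrite gt_eqF.
Qed.

Lemma local_form_diag_ge0 ta lam w :
  sym_posdef2 ta -> admissible_lam ta lam -> 0 <= local_form ta lam w w.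
Proof.
move=> taP lamP; have [_ _ _ X0] := admissible_lam_bounds taP lamP.
have [_ p0 _ det0] := taP; rewrite local_form_diag //.
apply: addr_ge0; first apply: addr_ge0.
- by rewrite divr_ge0 ?sqr_ge0 ?ltW.
- by apply: divr_ge0; [apply: mulr_ge0; [lra | exact: sqr_ge0] | exact: ltW].
- by rewrite mulr_ge0 ?sqr_ge0 ?ltW.
Qed.

Lemma local_form_diag_eq0 ta lam w :
  sym_posdef2 ta -> admissible_lam ta lam -> local_form ta lam w w <= 0 ->
  [/\ mean1 w = 0, mean2 w = 0 & mixed w = 0].
Proof.
move=> taP lamP; have [_ _ _ X0] := admissible_lam_bounds taP lamP.
have [_ p0 _ det0] := taP; rewrite local_form_diag // => le0.
set u := _ ^+ 2 / _ in le0; set v := _ / _ in le0; set x := _ * mixed w ^+ 2 in le0.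
have u0 : 0 <= u by rewrite divr_ge0 ?sqr_ge0 ?ltW.
have v0 : 0 <= v.
  by apply: divr_ge0; [apply: mulr_ge0; [lra | exact: sqr_ge0] | exact: ltW].
have x0 : 0 <= x by rewrite mulr_ge0 ?sqr_ge0 ?ltW.
have /eqP : x = 0 by lra.
rewrite mulf_eq0 (gt_eqF X0) sqrf_eq0 /= => /eqP mixed0.
have /eqP : v = 0 by lra.
rewrite /v mulf_eq0 invr_eq0 (gt_eqF p0) orbF mulf_eq0 sqrf_eq0 subr_eq0 (gt_eqF det0) /=.
move=> /eqP mean20; split=> //; have /eqP : u = 0 by lra.
rewrite /u mulf_eq0 invr_eq0 (gt_eqF p0) orbF sqrf_eq0.
by rewrite mean20 mulr0 addr0 mulf_eq0 (gt_eqF p0) => /eqP.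
Qed.

End LocalForm.

Lemma ord2P (P : 'I_2 -> Prop) : P 0 -> P 1 -> forall i, P i.
Proof.
by move=> P0 P1 [[|[|//]] lti];
  [rewrite (_ : Ordinal lti = 0) | rewrite (_ : Ordinal lti = 1)];
  first [exact: val_inj | done].
Qed.

Lemma sum_ord2 (V : nmodType) (F : 'I_2 -> V) : \sum_(i < 2) F i = F 0 + F 1.
Proof.
rewrite big_ord_recl big_ord1; congr (_ + F _); exact: val_inj.
Qed.

(** * Bilinear interpolation, gradients and quadrature on the reference square *)

Section Element.
Context {R : realType}.
Implicit Types (w : bool -> bool -> R) (q : quad R) (f g : 'cV[R]_2 -> R).
Implicit Types (x y : 'cV[R]_2).

Lemma vec2E0 (s t : R) : vec2 s t 0 0 = s. Proof. by rewrite mxE. Qed.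
Lemma vec2E1 (s t : R) : vec2 s t 1 0 = t. Proof. by rewrite mxE. Qed.

Lemma dotE (u v : 'cV[R]_2) : dot u v = u 0 0 * v 0 0 + u 1 0 * v 1 0.
Proof. by rewrite /dot mxE sum_ord2 !mxE. Qed.

Lemma det_mx2 (A : 'M[R]_2) : \det A = A 0 0 * A 1 1 - A 0 1 * A 1 0.
Proof.
rewrite (expand_det_row _ 0) sum_ord2 /cofactor !det_mx11 !mxE /=.
rewrite /bump /= expr0 expr1.
have -> : lift 0 0 = 1 :> 'I_2 by exact: val_inj.
have -> : lift 1 0 = 0 :> 'I_2 by exact: val_inj.
by ring.
Qed.

Lemma turnE (p r s : 'cV[R]_2) : turn p r s =
  (r 0 0 - p 0 0) * (s 1 0 - r 1 0) - (s 0 0 - r 0 0) * (r 1 0 - p 1 0).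
Proof.
have L (A B : 'cV[R]_2) i : (row_mx A B : 'M[R]_2) i 0 = A i 0.
  by rewrite -(row_mxEl A B); congr (row_mx _ _ _ _); exact: val_inj.
have Rr (A B : 'cV[R]_2) i : (row_mx A B : 'M[R]_2) i 1 = B i 0.
  by rewrite -(row_mxEr A B); congr (row_mx _ _ _ _); exact: val_inj.
by rewrite /turn det_mx2 !L !Rr !mxE.
Qed.

Definition corner (l m : bool) : 'cV[R]_2 := vec2 l%:R m%:R.

Lemma KhatE x : Khat x <-> (0 <= x 0 0 <= 1) /\ (0 <= x 1 0 <= 1).
Proof. by split=> [Kx|[? ?]]; [split | apply: ord2P]. Qed.

Lemma Khat_corner l m : Khat (corner l m).
Proof.
by apply/KhatE; rewrite vec2E0 vec2E1; case: l m => -[] /=; rewrite !lexx ler01.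
Qed.

Definition interp w x : R :=
  (1 - x 0 0) * ((1 - x 1 0) * w false false + x 1 0 * w false true)
  + x 0 0 * ((1 - x 1 0) * w true false + x 1 0 * w true true).

Lemma Fmap_interp q x i : Fmap q x i 0 = interp (fun l m => q l m i 0) x.
Proof.
by rewrite /Fmap !big_bool /= !mxE /phihat /interp; ring.
Qed.

Lemma Fmap_corner q l m : Fmap q (corner l m) = q l m.
Proof.
apply/colP => i; rewrite Fmap_interp /interp vec2E0 vec2E1.
by case: l m => -[] /=; ring.
Qed.

(** [interp1] and [interp2] are the partial derivatives of [interp w]. As [interp w] is affine along
    each axis, its difference quotients equal them exactly, and every limit below is that of a
    constant. *)
Definition interp1 w x : R :=
  (1 - x 1 0) * (w true false - w false false) + x 1 0 * (w true true - w false true).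
Definition interp2 w x : R :=
  (1 - x 0 0) * (w false true - w false false) + x 0 0 * (w true true - w true false).

Lemma interp_line1 w x (h : R) :
  interp w (x + h *: delta_mx 0 0) = interp w x + h * interp1 w x.
Proof. by rewrite /interp /interp1 !mxE /=; ring. Qed.

Lemma interp_line2 w x (h : R) :
  interp w (x + h *: delta_mx 1 0) = interp w x + h * interp2 w x.
Proof. by rewrite /interp /interp2 !mxE /=; ring. Qed.

Lemma bilinear_interp f x : bilinear_on_Khat f -> Khat x ->
  f x = interp (fun l m => f (corner l m)) x.
Proof.
case=> b0 [b1 [b2 [b3 fE]]] Kx; rewrite /interp !fE //; try exact: Khat_corner.
by rewrite !vec2E0 !vec2E1 /=; ring.
Qed.

(** Makes the limit in [grad_Khat] meaningful at boundary nodes too: from any point of the square,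
    arbitrarily small nonzero steps along each axis stay inside. *)
Lemma within_Khat_line_proper x (i : 'I_2) : Khat x ->
  ProperFilter (within [set h | Khat (x + h *: delta_mx i 0)] (0 : R)^').
Proof.
move=> Kx; apply: Build_ProperFilter_ex => A /nbhs_ballP [e /= e0 eA].
have d0 : 0 < Num.min (e / 2) (1 / 2) by rewrite lt_min; apply/andP; lra.
have [de dh] : Num.min (e / 2) (1 / 2) <= e / 2 /\ Num.min (e / 2) (1 / 2) <= 1 / 2.
  by rewrite !ge_min !lexx orbT.
move: (Num.min _ _) d0 de dh => d d0 de dh.
have Kline h : 0 <= x i 0 + h <= 1 -> Khat (x + h *: delta_mx i 0).
  move=> xh j; rewrite !mxE eqxx andbT; have [->|_] := eqVneq j i.
    by rewrite mulr1.
  by rewrite mulr0 addr0.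
have /andP[xi0 xi1] := Kx i.
(* Moving away from the nearer side, a step of length at most 1/2 cannot leave the square. *)
have [xh|xh] := leP (x i 0) (1 / 2).
  exists d; apply: eA.
  - by rewrite /ball /= sub0r normrN gtr0_norm //; lra.
  - by rewrite /= gt_eqF.
  - by apply: Kline; lra.
exists (- d); apply: eA.
- by rewrite /ball /= sub0r opprK gtr0_norm //; lra.
- by rewrite /= oppr_eq0 gt_eqF.
- by apply: Kline; lra.
Qed.

Lemma lim_line_Khat f x i (l : R) : Khat x ->
  (forall h, h != 0 -> Khat (x + h *: delta_mx i 0) ->
     f (x + h *: delta_mx i 0) = f x + h * l) ->
  lim ((fun h : R => h^-1 * (f (x + h *: delta_mx i 0) - f x)) @
         within [set h | Khat (x + h *: delta_mx i 0)] (0 : R)^') = l.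
Proof.
move=> Kx fE; have FF := within_Khat_line_proper i Kx; apply: lim_near_cst => //.
apply/nbhs_ballP; exists 1 => //= h _ h0 Kh.
by rewrite fE // addrC addKr mulKf.
Qed.

Lemma grad_KhatE f x : bilinear_on_Khat f -> Khat x ->
  let w l m := f (corner l m) in
  grad_Khat f x = vec2 (interp1 w x) (interp2 w x).
Proof.
move=> fbil Kx w; apply/colP; apply: ord2P; rewrite ?vec2E0 ?vec2E1 mxE;
  apply: lim_line_Khat => // h _ Kh.
  by rewrite !(bilinear_interp fbil) // interp_line1.
by rewrite !(bilinear_interp fbil) // interp_line2.
Qed.

Lemma DF_center q i :
  DF q (Defs.center R) i 0 =
    (q true false i 0 - q false false i 0 + q true true i 0 - q false true i 0) / 2 /\
  DF q (Defs.center R) i 1 =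
    (q false true i 0 - q false false i 0 + q true true i 0 - q true false i 0) / 2.
Proof.
have derE j (l : R) :
    (forall h, Fmap q (Defs.center R + h *: delta_mx j 0) i 0 =
               Fmap q (Defs.center R) i 0 + h * l) ->
    'D_(delta_mx j 0) (fun y => Fmap q y i 0) (Defs.center R) = l.
  move=> FE; rewrite /derive; apply: lim_near_cst; first exact: norm_hausdorff.
  apply/nbhs_ballP; exists 1 => //= h _ h0.
  by rewrite [h *: delta_mx j 0 + _]addrC FE addrAC subrr add0r /GRing.scale /= mulKf.
by split; rewrite mxE; apply: derE => h; rewrite !Fmap_interp ?interp_line1 ?interp_line2
  /interp1 /interp2 /Defs.center ?vec2E0 ?vec2E1; field.
Qed.

(** The Jacobian determinant of a bilinear map is affine, so its value at the center is the mean of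
    its corner values. These are the four turns, which share one strict sign. *)
Lemma det_DF_center_neq0 q : convex_quad q -> \det (DF q (Defs.center R)) != 0.
Proof.
have [[A00 A01] [A10 A11]] := (DF_center q 0, DF_center q 1).
have detE : \det (DF q (Defs.center R)) * 4 =
    turn (q false false) (q true false) (q true true)
  + turn (q true false) (q true true) (q false true)
  + turn (q true true) (q false true) (q false false)
  + turn (q false true) (q false false) (q true false).
  by rewrite !turnE det_mx2 A00 A01 A10 A11; field.
by case=> -[h1 h2 h3 h4]; apply/eqP => d0; rewrite d0 mul0r in detE; lra.
Qed.

Lemma quadrature3 (lam : R * R) f : quadrature lam f =
  lam.1 / 2 *
      (lam.2 / 2 * f (vec2 0 0) + (1 - lam.2) * f (vec2 0 (1 / 2))
       + lam.2 / 2 * f (vec2 0 1))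
  + (1 - lam.1) *
      (lam.2 / 2 * f (vec2 (1 / 2) 0) + (1 - lam.2) * f (vec2 (1 / 2) (1 / 2))
       + lam.2 / 2 * f (vec2 (1 / 2) 1))
  + lam.1 / 2 *
      (lam.2 / 2 * f (vec2 1 0) + (1 - lam.2) * f (vec2 1 (1 / 2))
       + lam.2 / 2 * f (vec2 1 1)).
Proof.
by rewrite /quadrature !big_ord_recl !big_ord0 /omega /xi /=; ring.
Qed.

Lemma quadrature_vertices f :
  quadrature (1, 1) f = (\sum_(l : bool) \sum_(m : bool) f (corner l m)) / 4.
Proof. by rewrite quadrature3 !big_bool /corner /=; field. Qed.

(** Each gradient component is affine in the other coordinate, with slope twice [mixed]. The
    one-dimensional rule is exact on affine functions and has variance lambda / 4, so lambda enters
    only through products of slopes in the same variable. In the cross terms the slopes belong to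
    different variables and only the means survive. *)
Lemma quadrature_stiffness (ta : 'M[R]_2) lam f g :
  bilinear_on_Khat f -> bilinear_on_Khat g ->
  quadrature lam (fun x => dot (ta *m grad_Khat f x) (grad_Khat g x)) =
  local_form ta lam (fun l m => f (corner l m)) (fun l m => g (corner l m)).
Proof.
move=> fbil gbil; set w := fun l m => f _; set w' := fun l m => g _.
have E (s t : R) : 0 <= s <= 1 -> 0 <= t <= 1 ->
  dot (ta *m grad_Khat f (vec2 s t)) (grad_Khat g (vec2 s t)) =
    (ta 0 0 * interp1 w (vec2 s t) + ta 0 1 * interp2 w (vec2 s t))
      * interp1 w' (vec2 s t)
  + (ta 1 0 * interp1 w (vec2 s t) + ta 1 1 * interp2 w (vec2 s t))
      * interp2 w' (vec2 s t).
  move=> s01 t01; have Kst : Khat (vec2 s t) by apply/KhatE; rewrite vec2E0 vec2E1.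
  rewrite !grad_KhatE // dotE !mxE !sum_ord2 !vec2E0 !vec2E1 //.
rewrite quadrature3 !E; try by apply/andP; lra.
rewrite /interp1 /interp2 !vec2E0 !vec2E1 /local_form /mean1 /mean2 /mixed.
case: lam => l1 l2 /=; move: (w _ _) (w _ _) (w _ _) (w _ _).
move: (w' _ _) (w' _ _) (w' _ _) (w' _ _).
by move=> a1 a2 a3 a4 b1 b2 b3 b4; field.
Qed.

End Element.

(** * Positive definiteness of the transformed coefficient *)

Section Coefficients.
Context {R : realType}.
Implicit Types (ta : 'M[R]_2) (q : quad R).

Lemma sym_posdef2_dot ta : ta^T = ta ->
  (forall z : 'cV[R]_2, z != 0 -> 0 < dot z (ta *m z)) -> sym_posdef2 ta.
Proof.
move=> /matrixP/(_ 0 1); rewrite mxE => tsym pos.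
have posE (s t : R) : s != 0 \/ t != 0 ->
    0 < ta 0 0 * s ^+ 2 + 2 * ta 0 1 * (s * t) + ta 1 1 * t ^+ 2.
  move=> st0; have /pos : vec2 s t != 0.
    apply/eqP => /colP z0; move: (z0 0) (z0 1).
    by rewrite vec2E0 vec2E1 !mxE; case: st0 => /eqP.
  rewrite dotE !mxE !sum_ord2 vec2E0 vec2E1 tsym.
  by rewrite /= !expr2; lra.
have p0 : 0 < ta 0 0.
  by have := posE 1 0 (or_introl (oner_neq0 _)); rewrite !expr2; lra.
have q0 : 0 < ta 1 1.
  by have := posE 0 1 (or_intror (oner_neq0 _)); rewrite !expr2; lra.
split=> //; rewrite -subr_gt0 -(pmulr_rgt0 _ p0).
(* At this vector the quadratic form equals [ta 0 0] times the determinant. *)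
have := posE (ta 0 1) (- ta 0 0); rewrite oppr_eq0 (gt_eqF p0) => /(_ (or_intror _)).
by move=> /(_ isT); rewrite !expr2; lra.
Qed.

(** [atilde] is a positive multiple of a matrix congruent to [abar]; convexity makes the Jacobian at
    the center invertible. *)
Lemma sym_posdef2_atilde a q : convex_quad q ->
  (abar a q)^T = abar a q ->
  (exists2 alpha : R, 0 < alpha &
     forall z : 'cV[R]_2, alpha * dot z z <= dot z (abar a q *m z)) ->
  sym_posdef2 (atilde a q).
Proof.
move=> qconv asym [alpha alpha0 apos]; have det0 := det_DF_center_neq0 qconv.
have DFu : DF q (Defs.center R) \in unitmx by rewrite unitmxE unitfE.
rewrite /atilde; set P := invmx _; apply: sym_posdef2_dot.
  by rewrite linearZ /= !trmx_mul trmxK asym mulmxA.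
move=> z z0; have Pz0 : P^T *m z != 0.
  apply: contra_neq z0 => Pz0.
  by rewrite -(mul1mx z) -(trmx1 R 2) -(mulVmx DFu) trmx_mul -mulmxA Pz0 mulmx0.
have -> : dot z ((`|\det (DF q (Defs.center R))| *: (P *m abar a q *m P^T)) *m z) =
    `|\det (DF q (Defs.center R))| * dot (P^T *m z) (abar a q *m (P^T *m z)).
  by rewrite /dot -scalemxAl -scalemxAr mxE trmx_mul trmxK !mulmxA.
rewrite mulr_gt0 ?normr_gt0 //; apply: lt_le_trans (apos _).
rewrite mulr_gt0 // dotE -!expr2 lt_def addr_ge0 ?sqr_ge0 // andbT.
apply: contra_neq Pz0 => /eqP; rewrite paddr_eq0 ?sqr_ge0 // !sqrf_eq0.
by move=> /andP[/eqP z00 /eqP z10]; apply/colP; apply: ord2P; rewrite [RHS]mxE.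
Qed.

End Coefficients.

(** * The closed unit square and functions with finitely many values on it *)

Section Domain.
Context {R : realType}.

Lemma closure_Omega : closure (@Omega R) = @Khat R.
Proof.
apply/seteqP; split=> [p pO i|p Kp B].
  suff : closure ((fun y : 'cV[R]_2 => y i 0) @^-1` `[0, 1]) p.
    rewrite -(iffLR (closure_id _)) /= ?in_itv //.
    by apply: (iffLR (continuous_closedP _));
      [exact: coord_continuous | exact: itv_closed].
  apply: closureS pO => y /(_ i) /andP[y0 y1] /=; rewrite in_itv /=.
  by rewrite !ltW.
(* A point of the closed square is approached along the segment to the center, which is interior
   apart possibly from [p]. *)
have line_cont : (fun t : R => p + t *: (Defs.center R - p)) t @[t --> (0 : R)] --> p.
  rewrite -[X in _ --> X]addr0 -(scale0r (Defs.center R - p)).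
  by apply: cvgD; [exact: cvg_cst | exact: scalel_continuous].
move=> /line_cont /nbhs_ballP [e /= e0 eB].
have d0 : 0 < Num.min (e / 2) (1 / 2) by rewrite lt_min; apply/andP; lra.
have [de dh] : Num.min (e / 2) (1 / 2) <= e / 2 /\ Num.min (e / 2) (1 / 2) <= 1 / 2.
  by rewrite !ge_min !lexx orbT.
move: (Num.min _ _) d0 de dh => d d0 de dh.
exists (p + d *: (Defs.center R - p)); split; last first.
  by apply: eB; rewrite /ball /= sub0r normrN gtr0_norm //; lra.
have H (s : R) : 0 <= s <= 1 -> 0 < s + d * (1 / 2 - s) < 1.
  by move=> s01; apply/andP; split; nra.
by apply: ord2P; rewrite !mxE /=; apply: H; exact: Kp.
Qed.

Lemma Khat_ray (t : R) p : 0 <= t <= 1 -> Khat p -> Khat (t *: p).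
Proof. by move=> t01 Kp i; rewrite mxE; have := Kp i; move: t01; nra. Qed.

(* Along a ray from the origin the function takes finitely many values, so the
   intermediate value theorem forces it to be constant there. *)
Lemma finite_valued_const (u : 'cV[R]_2 -> R) (s : seq R) :
  {within @Khat R, continuous u} -> (forall p, Khat p -> u p \in s) ->
  forall p, Khat p -> u p = u 0.
Proof.
move=> ucont us p Kp.
have gcont : {within `[0, 1], continuous (fun t : R => u (t *: p))}.
  apply/subspace_continuousP => t; rewrite /= in_itv /= => t01.
  have := (iffLR (subspace_continuousP _ _) ucont) (t *: p) (Khat_ray t01 Kp).
  apply: cvg_comp => B /= /(@scalel_continuous _ _ p t) /=.
  move=> sB; apply: (@filterS _ (nbhs t) _ _ _ _ sB) => r rB.
  by rewrite /= in_itv /= => r01; exact: rB (Khat_ray r01 Kp).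
apply/eqP; apply: contraT => neq.
(* For [k] up to [size s] these are [size s + 1] distinct, equally spaced values from [u 0] to
   [u p]. The intermediate value theorem puts them all in [s], which is too short. *)
pose v (k : nat) : R := u 0 + (u p - u 0) * (k%:R / (size s)%:R).
have s0 : (0 < size s)%N by case: (s) (us p Kp).
have sR : 0 < (size s)%:R :> R by rewrite ltr0n.
suff : (size (map v (iota 0 (size s).+1)) <= size s)%N by rewrite size_map size_iota ltnn.
apply: uniq_leq_size.
  rewrite map_inj_uniq ?iota_uniq // => k l /addrI /mulfI.
  rewrite subr_eq0 => /(_ neq) /(mulIf (invr_neq0 (lt0r_neq0 sR))) /eqP.
  by rewrite eqr_nat => /eqP.
move=> _ /mapP[k + ->]; rewrite mem_iota /= add0n ltnS => ks.
have mid : Num.min (u (0 *: p)) (u (1 *: p)) <= v k <= Num.max (u (0 *: p)) (u (1 *: p)).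
  rewrite scale0r scale1r /v.
  have : 0 <= (k%:R / (size s)%:R : R) <= 1.
    by rewrite divr_ge0 // ler_pdivrMr // mul1r ler_nat.
  move: (_ / _) => r r01; rewrite /Num.min /Num.max.
  by case: ltP => ?; apply/andP; split; nra.
have [c] := IVT ler01 gcont mid.
by rewrite in_itv /= => c01 <-; apply/us/Khat_ray.
Qed.

End Domain.

(** * Assembly of the global form over the mesh *)

Section Assembly.
Context {R : realType}.
Implicit Types (q : quad R) (u v : 'cV[R]_2 -> R).

(** Diagonal entries of the lumped element mass matrix: at lambda = (1, 1) only the corners carry
    weight, a quarter each. *)
Definition mass_weight (c : 'cV[R]_2 -> R) q (l m : bool) : R :=
  c (q l m) * `|\det (DF q (corner l m))| / 4.

Lemma bilinear_formE (E : finType) (mesh : E -> quad R) a c lam u v :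
  (forall e, bilinear_on_Khat (u \o Fmap (mesh e))) ->
  (forall e, bilinear_on_Khat (v \o Fmap (mesh e))) ->
  bilinear_form mesh a c lam u v =
  \sum_(e : E) (local_form (atilde a (mesh e)) (lam e)
                  (fun l m => u (mesh e l m)) (fun l m => v (mesh e l m))
    + \sum_(l : bool) \sum_(m : bool)
        mass_weight c (mesh e) l m * (u (mesh e l m) * v (mesh e l m))).
Proof.
move=> ubil vbil; apply: eq_bigr => e _ /=; congr (_ + _).
  rewrite (quadrature_stiffness _ _ (ubil e) (vbil e)).
  by rewrite /local_form /mean1 /mean2 /mixed /= !Fmap_corner.
rewrite quadrature_vertices mulr_suml; apply: eq_bigr => l _.
rewrite mulr_suml; apply: eq_bigr => m _.
by rewrite Fmap_corner /mass_weight; ring.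
Qed.

Section LinearCombination.
Variables (N : nat) (z : 'I_N -> R).

Let comb (w : 'I_N -> bool -> bool -> R) l m := \sum_j z j * w j l m.

(** The outer index goes with the second factor, to match [stiffness], whose rows are indexed by the
    test function. *)
Lemma quad_sum (K : R) (x y : 'I_N -> R) :
  K * ((\sum_j z j * x j) * (\sum_i z i * y i)) =
  \sum_i \sum_j z i * (K * (x j * y i)) * z j.
Proof.
rewrite mulr_sumr mulr_sumr; apply: eq_bigr => i _.
by rewrite mulr_suml mulr_sumr; apply: eq_bigr => j _; ring.
Qed.

Lemma local_form_comb ta lam (w : 'I_N -> bool -> bool -> R) :
  local_form ta lam (comb w) (comb w) =
  \sum_i \sum_j z i * local_form ta lam (w j) (w i) * z j.
Proof.
have m1 : mean1 (comb w) = \sum_j z j * mean1 (w j).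
  rewrite /mean1 /comb -!big_split -!sumrB mulr_suml.
  by apply: eq_bigr => j _; rewrite /=; ring.
have m2 : mean2 (comb w) = \sum_j z j * mean2 (w j).
  rewrite /mean2 /comb -!big_split -!sumrB mulr_suml.
  by apply: eq_bigr => j _; rewrite /=; ring.
have mx : mixed (comb w) = \sum_j z j * mixed (w j).
  rewrite /mixed /comb -!big_split -!sumrB mulr_suml.
  by apply: eq_bigr => j _; rewrite /=; ring.
rewrite /local_form m1 m2 mx !quad_sum -!big_split /=; apply: eq_bigr => i _.
by rewrite -!big_split /=; apply: eq_bigr => j _; ring.
Qed.

Lemma mass_comb (M : bool -> bool -> R) (w : 'I_N -> bool -> bool -> R) :
  \sum_(l : bool) \sum_(m : bool) M l m * (comb w l m * comb w l m) =
  \sum_i \sum_j z i *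
    (\sum_(l : bool) \sum_(m : bool) M l m * (w j l m * w i l m)) * z j.
Proof.
rewrite !big_bool /= /comb !quad_sum -!big_split /=; apply: eq_bigr => i _.
by rewrite -!big_split /=; apply: eq_bigr => j _; rewrite !big_bool /=; ring.
Qed.

Lemma interp_comb (w : 'I_N -> bool -> bool -> R) x :
  interp (comb w) x = \sum_j z j * interp (w j) x.
Proof.
rewrite /interp /comb !mulr_sumr -!big_split /= !mulr_sumr -!big_split /=.
by apply: eq_bigr => j _; ring.
Qed.

End LinearCombination.

Lemma interp_const w (x : 'cV[R]_2) :
  mean1 w = 0 -> mean2 w = 0 -> mixed w = 0 -> interp w x = w false false.
Proof.
rewrite /mean1 /mean2 /mixed => e1 e2 e3.
have -> : interp w x = interp (fun _ _ => w false false) x.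
  by rewrite /interp; congr (_ * (_ * _ + _ * _) + _ * (_ * _ + _ * _)); lra.
by rewrite /interp; ring.
Qed.

Lemma Fmap_vertex_weight (x : 'cV[R]_2) : Khat x ->
  exists l m, 0 < phihat l m x.
Proof.
(* The nearest corner: both factors of its shape function are at least 1/2. *)
move=> Kx; exists (1 / 2 <= x 0 0), (1 / 2 <= x 1 0).
have := Kx 0; have := Kx 1; rewrite /phihat.
by case: (leP (1 / 2) (x 0 0)) => ?; case: (leP (1 / 2) (x 1 0)) => ?;
  move=> /andP[??] /andP[??]; rewrite mulr_gt0 //; lra.
Qed.

(** The origin is an extreme point of the square: a convex combination of vectors with nonnegative
    coordinates vanishes only if every vector of positive weight does. Hence an element containing
    the origin has it as a vertex. *)
Lemma zero_vertex q x : (forall l m, Khat (q l m)) -> Khat x ->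
  Fmap q x = 0 -> exists l m, q l m = 0.
Proof.
move=> Kq Kx /colP F0; have [l [m lm0]] := Fmap_vertex_weight Kx.
exists l, m; apply/colP => i; rewrite [RHS]mxE.
have phi0 l' m' : 0 <= phihat l' m' x.
  have := Kx 0; have := Kx 1; rewrite /phihat => /andP[? ?] /andP[? ?].
  by rewrite mulr_ge0 //; [case: l' | case: m'] => //; lra.
have T0 l' m' : 0 <= phihat l' m' x * q l' m' i 0.
  by rewrite mulr_ge0 //; have /andP[] := Kq l' m' i.
suff /eqP : phihat l m x * q l m i 0 = 0.
  by rewrite mulf_eq0 (gt_eqF lm0) => /eqP.
have := F0 i; rewrite /Fmap !big_bool /= !mxE.
have := T0 false false; have := T0 true false.
have := T0 false true; have := T0 true true.
by case: l {lm0}; case: m => /=; lra.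
Qed.

Lemma within_continuous_comb (A : set 'cV[R]_2) N (z : 'I_N -> R)
    (f : 'I_N -> 'cV[R]_2 -> R) :
  (forall j, {within A, continuous (f j)}) ->
  {within A, continuous (fun p => \sum_j z j * f j p)}.
Proof.
move=> fcont p; apply: cvg_big => [|j _]; first exact: add_continuous.
by apply: cvgMl_tmp; exact: fcont.
Qed.

End Assembly.

Theorem theorem5p1 (R : realType)
  (a : 'cV[R]_2 -> 'M[R]_2) (c : 'cV[R]_2 -> R)
  (a_cont : {within closure (@Omega R), continuous a})
  (c_cont : {within closure (@Omega R), continuous c})
  (a_sym : forall x, closure (@Omega R) x -> (a x)^T = a x)
  (a_pos : unif_posdef (closure (@Omega R)) a)
  (c_ge0 : forall x, closure (@Omega R) x -> 0 <= c x)
  (E : finType) (mesh : E -> quad R)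
  (mesh_conf : conforming_mesh mesh)
  (N : nat) (N_gt0 : (0 < N)%N)
  (x : 'I_N -> 'cV[R]_2) (x_int : interior_vertices mesh x)
  (phi : 'I_N -> 'cV[R]_2 -> R) (phi_basis : nodal_basis mesh x phi)
  (lam : E -> R * R)
  (mesh_cond : forall e, coef_condition (atilde a (mesh e)) \/
                         mesh_condition (mesh e) (abar a (mesh e)))
  (lam_adm : forall e, admissible_lam (atilde a (mesh e)) (lam e)) :
  nonsingular_M_matrix (stiffness mesh a c lam phi).
Proof.
have [conv cover _] := mesh_conf; have [x_inj xP] := x_int.
rewrite closure_Omega in a_sym a_pos c_ge0 cover.
have meshK e y : Khat y -> Khat (Fmap (mesh e) y).
  by move=> Ky; rewrite -cover; exists e => //; exists y.
have vertexK e l m : Khat (mesh e l m).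
  by rewrite -Fmap_corner; apply/meshK/Khat_corner.
have taP e : sym_posdef2 (atilde a (mesh e)).
  have Kc : Khat (Fmap (mesh e) (Defs.center R)).
    by apply/meshK/KhatE; rewrite /Defs.center vec2E0 vec2E1; split; apply/andP; lra.
  apply: sym_posdef2_atilde => //; first exact: a_sym.
  by have [alpha alpha0 aP] := a_pos; exists alpha => // z; exact: aP.
have mass0 e l m : 0 <= mass_weight c (mesh e) l m.
  by rewrite /mass_weight divr_ge0 // mulr_ge0 // c_ge0.
have phi_bil j e : bilinear_on_Khat (phi j \o Fmap (mesh e)).
  by have [[_ bil] _ _] := phi_basis j; exact: bil.
have phix j : phi j (x j) = 1 by have [] := phi_basis j.
have phi0 j p : mesh_vertex mesh p -> p <> x j -> phi j p = 0.
  by have [_ _ off] := phi_basis j; exact: off.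
have vertexP e l m : mesh_vertex mesh (mesh e l m) by exists e, l, m.
have phi_ge0 j p : mesh_vertex mesh p -> 0 <= phi j p.
  by move=> pv; have [->|/eqP/phi0->//] := eqVneq p (x j); rewrite phix.
have phi_disj i j p : i != j -> mesh_vertex mesh p -> phi j p * phi i p = 0.
  move=> ij pv; have [pj|/eqP/phi0->//] := eqVneq p (x j); last by rewrite mul0r.
  by rewrite (phi0 i) ?mulr0 // pj => /x_inj ji; rewrite ji eqxx in ij.
(* At mesh vertices the basis functions are nonnegative and pairwise disjoint, so for distinct
   indices the lumped mass term vanishes and [local_form_le0] applies on each element. *)
apply: nonsingular_M_matrix_posdef => [i j ij|z].
  rewrite mxE bilinear_formE //; apply: sumr_le0 => e _.
  rewrite [X in _ + X]big1 => [|l _]; last first.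
    by apply: big1 => m _; rewrite phi_disj ?mulr0.
  by rewrite addr0; apply: local_form_le0 => // l m; rewrite ?phi_ge0 ?phi_disj.
pose u p := \sum_j z j * phi j p.
pose w e j l m := phi j (mesh e l m).
pose U e l m := \sum_j z j * w e j l m.
have -> : \sum_i \sum_j z i * stiffness mesh a c lam phi i j * z j =
    \sum_e (local_form (atilde a (mesh e)) (lam e) (U e) (U e)
      + \sum_(l : bool) \sum_(m : bool)
          mass_weight c (mesh e) l m * (U e l m * U e l m)).
  under [RHS]eq_bigr => e _.
    rewrite local_form_comb mass_comb -big_split /=.
    under eq_bigr => i _ do rewrite -big_split /=.
    over.
  rewrite [RHS]exchange_big; apply: eq_bigr => i _ /=.
  rewrite [RHS]exchange_big; apply: eq_bigr => j _ /=.
  rewrite mxE bilinear_formE // mulr_sumr mulr_suml.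
  by apply: eq_bigr => e _; rewrite mulrDr mulrDl.
move=> energy_le0.
have local0 e : 0 <= local_form (atilde a (mesh e)) (lam e) (U e) (U e).
  exact: local_form_diag_ge0.
have massU0 e : 0 <= \sum_(l : bool) \sum_(m : bool)
    mass_weight c (mesh e) l m * (U e l m * U e l m).
  by do 2!apply: sumr_ge0 => ? _; rewrite mulr_ge0 // -expr2 sqr_ge0.
(* The energy is a sum of nonnegative element terms and is at most 0, so each term is 0. As the mass
   part is nonnegative, the local form is at most 0, and its kernel consists of constants. *)
have u_const e y : Khat y -> u (Fmap (mesh e) y) = U e false false.
  move=> Ky; have energy0 : \sum_e (local_form (atilde a (mesh e)) (lam e) (U e) (U e)
      + \sum_(l : bool) \sum_(m : bool)
          mass_weight c (mesh e) l m * (U e l m * U e l m)) = 0.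
    by apply/le_anti; rewrite energy_le0 /= sumr_ge0 // => e' _; rewrite addr_ge0.
  have eq0 := psumr_eq0P (fun e' _ => addr_ge0 (local0 e') (massU0 e')) energy0.
  have Ue_le0 : local_form (atilde a (mesh e)) (lam e) (U e) (U e) <= 0.
    by rewrite -(eq0 e isT) lerDl.
  have [m1 m2 mx] := local_form_diag_eq0 (taP e) (lam_adm e) Ue_le0.
  rewrite -(interp_const y m1 m2 mx) interp_comb; apply: eq_bigr => j _.
  congr (_ * _); have := bilinear_interp (phi_bil j e) Ky.
  by rewrite /interp /= !Fmap_corner.
have u_cont : {within @Khat R, continuous u}.
  rewrite -closure_Omega; apply: within_continuous_comb => j.
  by have [[fcont _] _ _] := phi_basis j.
(* The constants of different elements are matched by continuity alone: [u] takes at most one value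
   per element, hence finitely many on the square. *)
have u_fin p : Khat p -> u p \in codom (fun e => U e false false).
  by rewrite -cover => -[e _ [y Ky <-]]; rewrite u_const //;
    exact: (codom_f (fun e => U e false false)).
have u_eq := finite_valued_const u_cont u_fin.
have xO i : Omega (x i) by have [] := (xP (x i)).1 (ex_intro _ i erefl).
(* The origin is a mesh vertex outside the open square, so it differs from every [x j] and all basis
   functions vanish there. *)
have u00 : u 0 = 0.
  have : Khat (0 : 'cV[R]_2) by move=> i; rewrite mxE lexx ler01.
  rewrite -cover => -[e _ [y Ky]] /(zero_vertex (vertexK e) Ky) [l [m lm0]].
  apply: big1 => j _; rewrite phi0 ?mulr0 // -?lm0 //; rewrite lm0 => x0.
  by have := xO j 0; rewrite -x0 mxE ltxx.
move=> i; have Kxi : Khat (x i) by move=> k; have /andP[??] := xO i k; rewrite !ltW.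
have := u_eq _ Kxi; rewrite u00 /u (bigD1 i) //= phix mulr1 big1 ?addr0 // => j ji.
have [pv _] := (xP (x i)).1 (ex_intro _ i erefl).
by rewrite phi0 ?mulr0 // => /x_inj ij; rewrite ij eqxx in ji.
Qed.
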